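(* For every positive integer $m$, $$\sum_{k=0}^{2m} (-1)^k \frac{B_{4m-2k}}{(4m-2k)!} \frac{B_{2k}}{(2k)!} = \sum_{j=0}^{m} (-4)^j \frac{B_{4m-4j}}{(4m-4j)!} \frac{B_{4j}}{(4j)!} - 2 \sum_{j=0}^{m-1} (-4)^j \frac{B_{4m-4j-2}}{(4m-4j-2)!} \frac{B_{4j+2}}{(4j+2)!}.$$
   Context: $B_n$ denotes the $n$-th Bernoulli number ($B_0 = 1$, $B_2 = 1/6$, $B_4 = -1/30$, ...). *)

(* Defs.v *)
From mathcomp Require Import all_boot all_order all_algebra.

Set Implicit Arguments.
Unset Strict Implicit.
Unset Printing Implicit Defensive.

Import GRing.Theory.
Local Open Scope ring_scope.

(* Course-of-values encoding, with the sequence [:: B_0; ...; B_n], of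
     B_0 = 1,   B_n = - 1 / (n + 1) * \sum_(k < n) 'C(n + 1, k) B_k  (0 < n),
   i.e. the coefficients of t / (e^t - 1) = \sum_n B_n t^n / n!.  With this
   choice B_1 = -1/2. *)
Fixpoint bernoulli_seq (n : nat) : seq rat :=
  if n is n'.+1 then
    let s := bernoulli_seq n' in
    rcons s (- (n.+1%:R^-1 * \sum_(k < n) 'C(n.+1, k)%:R * s`_k))
  else [:: 1].

Definition bernoulli (n : nat) : rat := (bernoulli_seq n)`_n.

Lemma size_bernoulli_seq n : size (bernoulli_seq n) = n.+1.
Proof. by elim: n => //= n IHn; rewrite size_rcons IHn. Qed.

Lemma nth_bernoulli_seq n k : (k <= n)%N -> (bernoulli_seq n)`_k = bernoulli k.
Proof.
elim: n => [|n IHn]; first by rewrite leqn0 => /eqP->.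
rewrite leq_eqVlt => /predU1P[-> //|lt_kn] /=.
by rewrite nth_rcons size_bernoulli_seq lt_kn IHn.
Qed.

Lemma bernoulli0 : bernoulli 0 = 1.
Proof. by []. Qed.

Lemma bernoulliS n :
  bernoulli n.+1 =
  - (n.+2%:R^-1 * \sum_(k < n.+1) 'C(n.+2, k)%:R * bernoulli k).
Proof.
rewrite {1}/bernoulli [bernoulli_seq _]/= nth_rcons size_bernoulli_seq ltnn eqxx.
by under eq_bigr => k _ do rewrite (nth_bernoulli_seq (leq_ord k)).
Qed.

Lemma sum_bernoulli n :
  \sum_(k < n.+2) 'C(n.+2, k)%:R * bernoulli k = 0.
Proof.
rewrite big_ord_recr /= bernoulliS binSn mulrN mulrA mulfV ?mul1r ?subrr //.
by rewrite Num.Theory.pnatr_eq0.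
Qed.

Lemma bernoulli1 : bernoulli 1 = - 2^-1.
Proof. by rewrite bernoulliS !big_ord_recr big_ord0 bernoulli0; apply/eqP. Qed.

Lemma bernoulli2 : bernoulli 2 = 6^-1.
Proof.
by rewrite bernoulliS !big_ord_recr big_ord0 /= bernoulli1 bernoulli0; apply/eqP.
Qed.

Lemma bernoulli3 : bernoulli 3 = 0.
Proof.
rewrite bernoulliS !big_ord_recr big_ord0 /= bernoulli2 bernoulli1 bernoulli0.
by apply/eqP.
Qed.

Lemma bernoulli4 : bernoulli 4 = - 30^-1.
Proof.
rewrite bernoulliS !big_ord_recr big_ord0 /=.
by rewrite bernoulli3 bernoulli2 bernoulli1 bernoulli0; apply/eqP.
Qed.

(* Main.v *)
(* With f(t) = (t / 2) coth (t / 2) = \sum_n B_2n t^2n / (2n)!, the left-hand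
   side is the coefficient of t^4m in f(t) f(it).  The addition formula
   coth (x + y) (coth x + coth y) = 1 + coth x coth y, taken at x = t / 2 and
   y = it / 2, gives
     (1 + i) f(t) f(it) = f((1 + i) t) (i f(t) + f(it)) - i (1 + i) t^2 / 4,
   and (1 + i)^4 = -4 turns the coefficient of t^4m on the right into the
   right-hand side.  Power series are represented by polynomials modulo a
   power of 'X. *)
Require Import Defs.
From mathcomp Require Import all_boot all_order all_algebra all_field.
From mathcomp Require Import ring zify.

Set Implicit Arguments.
Unset Strict Implicit.
Unset Printing Implicit Defensive.

Import GRing.Theory Num.Theory.

Local Open Scope ring_scope.

Section DvdXn.

Variable F : fieldType.
Implicit Types p d : {poly F}.

Lemma dvdXnP n p : reflect (forall i, (i < n)%N -> p`_i = 0) ('X^n %| p).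
Proof.
apply: (iffP idP) => [/dvdpP[q ->] i lt_in | p0]; first by rewrite coefMXn lt_in.
rewrite -[p](poly_take_drop n) (_ : take_poly n p = 0) ?add0r ?dvdp_mulIr //.
by apply/polyP => i; rewrite coef_take_poly coef0; case: ifP => // /p0.
Qed.

(** The hypotheses on [d] make it ['X] times a polynomial coprime to ['X], so cancelling it costs
    exactly one order of precision. *)
Lemma dvdXn_cancel n p d :
  d`_0 = 0 -> d`_1 != 0 -> 'X^(n.+1) %| p * d -> 'X^n %| p.
Proof.
move=> d0 d1; have /dvdpP[q dE] : 'X^1 %| d by apply/dvdXnP => -[].
have q0 : q`_0 != 0 by move: d1; rewrite dE coefMXn.
rewrite dE mulrA exprSr expr1 dvdp_mul2r ?polyX_eq0 // Gauss_dvdpl //.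
by rewrite coprimep_expl // coprimep_sym coprimepX /root horner_coef0.
Qed.

End DvdXn.

Lemma big_ord_odd_even (V : zmodType) (G : nat -> V) n :
  \sum_(k < (2 * n).+1) G k
  = \sum_(j < n.+1) G (2 * j)%N + \sum_(j < n) G (2 * j).+1.
Proof.
elim: n => [|n IHn]; first by rewrite !big_ord_recl !big_ord0 !addr0.
rewrite mulnS !addSn add0n 2!big_ord_recr /= IHn.
rewrite [in RHS]big_ord_recr [X in _ = _ + X]big_ord_recr /= mulnS !addSn add0n.
by rewrite -!addrA; congr (_ + _); rewrite addrCA addrC -addrA [RHS]addrCA.
Qed.

Definition bernoulli_egf (n : nat) : rat := bernoulli n / n`!%:R.

(* Coefficients of (t / 2) coth (t / 2) = t / (e^t - 1) + t / 2. *)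
Definition coth_coef (n : nat) : rat :=
  bernoulli_egf n + (n == 1)%:R / 2.

Lemma fact_neq0 (R : numDomainType) n : n`!%:R != 0 :> R.
Proof. by rewrite pnatr_eq0 -lt0n fact_gt0. Qed.

(** Coefficient of t^n in t / (e^t - 1) times e^t - 1. The term k = n is absent because e^t - 1 has
    no constant term. *)
Lemma sum_bernoulli_egf n :
  \sum_(k < n) bernoulli_egf k / (n - k)`!%:R = (n == 1)%:R.
Proof.
case: n => [|[|n]]; rewrite ?big_ord0 // ?big_ord1 //=.
rewrite -[RHS](mul0r (n.+2)`!%:R^-1) -[in RHS](sum_bernoulli n) mulr_suml.
apply: eq_bigr => k _; rewrite /bernoulli_egf -(bin_fact (ltnW (ltn_ord k))).
rewrite !natrM; field; rewrite !fact_neq0 /= pnatr_eq0 -lt0n bin_gt0.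
exact: ltnW.
Qed.

Section Truncated.

Variables (R : numFieldType) (N : nat).
Implicit Types x y : R.

Definition exp_poly x : {poly R} := \poly_(n < N) (x ^+ n / n`!%:R).

(* Truncation of the series of x t coth (x t / 2), i.e. 2 f(x t). *)
Definition coth_poly x : {poly R} :=
  \poly_(n < N) (2 * ratr (coth_coef n) * x ^+ n).

Lemma exp_polyD x y : 'X^N %| exp_poly (x + y) - exp_poly x * exp_poly y.
Proof.
apply/dvdXnP => n ltnN; rewrite coefB coefMr coef_poly ltnN.
apply/eqP; rewrite subr_eq0; apply/eqP.
rewrite exprDn mulr_suml; apply: eq_bigr => i _.
have le_in := leq_ord i.
rewrite !coef_poly (leq_ltn_trans _ ltnN) ?leq_subr // (leq_ltn_trans le_in) //.
rewrite -mulr_natr -(bin_fact le_in) !natrM; field.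
by rewrite !fact_neq0 pnatr_eq0 -lt0n bin_gt0 le_in.
Qed.

(** Let b = x t / (e^(x t) - 1), truncated as [b_poly]. Then x t coth (x t / 2) = 2 b + x t, and
    multiplying by e^(x t) - 1 gives 2 x t + x t (e^(x t) - 1). *)
Lemma coth_polyM x :
  'X^N %| coth_poly x * (exp_poly x - 1) - (x *: 'X) * (1 + exp_poly x).
Proof.
pose b_poly : {poly R} := \poly_(n < N) (ratr (bernoulli_egf n) * x ^+ n).
have coth_bern : 'X^N %| coth_poly x - (2 *: b_poly + x *: 'X).
  apply/dvdXnP => n ltnN; rewrite !(coefB, coefD, coefZ, coef_poly, coefX) ltnN.
  rewrite /coth_coef; move: (bernoulli_egf n) => b.
  rewrite rmorphD fmorph_div !rmorph_nat /=.
  by case: eqP => [->|_] /=; field.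
have b_exp : 'X^N %| b_poly * (exp_poly x - 1) - x *: 'X.
  apply/dvdXnP => n ltnN; rewrite coefB coefM coefZ coefX.
  rewrite big_ord_recr /= subnn !(coefB, coef_poly, coef1) ltnN.
  rewrite (leq_ltn_trans _ ltnN) // expr0 fact0 divr1 subrr mulr0 addr0.
  rewrite (_ : x * _ = x ^+ n * ratr (n == 1)%:R); last first.
    by rewrite rmorph_nat; case: eqP => [->|_]; rewrite ?expr1 ?mulr0.
  rewrite -sum_bernoulli_egf rmorph_sum mulr_sumr; apply/eqP.
  rewrite subr_eq0; apply/eqP/eq_bigr => k _; have lt_kn := ltn_ord k.
  rewrite !(coefB, coef_poly, coef1) (ltn_trans lt_kn) //.
  rewrite (leq_ltn_trans (leq_subr _ _)) // subn_eq0 leqNgt lt_kn subr0.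
  rewrite rmorphM fmorphV rmorph_nat /=.
  have -> : x ^+ n = x ^+ k * x ^+ (n - k) by rewrite -exprD subnKC // ltnW.
  by field; exact: fact_neq0.
rewrite (_ : _ - _ = (coth_poly x - (2 *: b_poly + x *: 'X)) * (exp_poly x - 1)
   + 2%:P * (b_poly * (exp_poly x - 1) - x *: 'X)); last first.
  by rewrite -!mul_polyC; ring.
by apply: dvdp_add; [exact: dvdp_mulr | exact: dvdp_mull].
Qed.

End Truncated.

Lemma exp_polyB1_coef0 (R : numFieldType) N (x : R) : (exp_poly N.+1 x - 1)`_0 = 0.
Proof. by rewrite coefB coef_poly coef1 /= expr0 fact0 divr1 subrr. Qed.

Lemma exp_polyB1_coef1 (R : numFieldType) N (x : R) : (exp_poly N.+2 x - 1)`_1 = x.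
Proof. by rewrite coefB coef_poly coef1 /= expr1 divr1 subr0. Qed.

(** The function t coth (t / 2) is even: its series at t and -t agree after multiplication by e^t -
    1, thanks to e^t e^(-t) = 1. Hence an odd coefficient equals its opposite. *)
Lemma coth_coef_odd n : odd n -> coth_coef n = 0.
Proof.
move=> odd_n; have n_lt : (n < n.+2)%N by [].
have : 'X^(n.+1) %| coth_poly n.+2 (-1 : rat) - coth_poly n.+2 1.
  apply: (@dvdXn_cancel _ _ _ (exp_poly n.+2 1 - 1)).
  - exact: exp_polyB1_coef0.
  - by rewrite exp_polyB1_coef1 oner_neq0.
  have exp0 : 'X^(n.+2) %| exp_poly n.+2 (0 : rat) - 1.
    apply/dvdXnP => -[|k] lt_k; rewrite coefB coef_poly lt_k coef1 expr0n //=.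
    by rewrite mul0r subr0.
  have := exp_polyD n.+2 (1 : rat) (-1); rewrite subrr => /dvdp_sub/(_ exp0).
  have := coth_polyM n.+2 (1 : rat); have := coth_polyM n.+2 (-1 : rat).
  set g := coth_poly _ 1; set g' := coth_poly _ _.
  set e := exp_poly _ 1; set e' := exp_poly _ (-1); set e0 := exp_poly _ 0.
  rewrite scale1r scaleN1r => gM' gM ee'.
  rewrite (_ : (g' - g) * (e - 1) = - e * (g' * (e' - 1) - - 'X * (1 + e'))
     - (g' + 'X) * (e0 - e * e' - (e0 - 1))
     - (g * (e - 1) - 'X * (1 + e))); last by ring.
  by apply: dvdp_sub => //; apply: dvdp_sub; apply: dvdp_mull.
move=> /dvdXnP/(_ n (leqnn _)); rewrite coefB !coef_poly n_lt expr1n.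
rewrite -signr_odd odd_n expr1 => /eqP.
rewrite mulrN1 mulr1 -opprD oppr_eq0 -mulr2n mulrn_eq0 mulf_eq0 fmorph_eq0 /=.
by move=> /eqP.
Qed.

(* The addition formula of coth with denominators cleared.  It is proved after
   multiplication by the e^z - 1 for z = x, y, x + y, which costs three orders
   of precision since each of them is 'X times a unit. *)
Lemma coth_poly_add (R : numFieldType) N (x y : R) :
  x != 0 -> y != 0 -> x + y != 0 ->
  'X^N %| (x + y) *: (coth_poly N.+3 x * coth_poly N.+3 y)
          - coth_poly N.+3 (x + y) * (y *: coth_poly N.+3 x + x *: coth_poly N.+3 y)
          + (x * y * (x + y)) *: 'X^2.
Proof.
move=> x0 y0 xy0; set W := (W in _ %| W).
pose d (z : R) := exp_poly N.+3 z - 1.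
apply: (@dvdXn_cancel _ _ _ (d x)); rewrite ?exp_polyB1_coef0 ?exp_polyB1_coef1 //.
apply: (@dvdXn_cancel _ _ _ (d y)); rewrite ?exp_polyB1_coef0 ?exp_polyB1_coef1 //.
apply: (@dvdXn_cancel _ _ _ (d (x + y)));
  rewrite ?exp_polyB1_coef0 ?exp_polyB1_coef1 //.
have := exp_polyD N.+3 x y.
have := coth_polyM N.+3 x; have := coth_polyM N.+3 y.
have := coth_polyM N.+3 (x + y); rewrite {}/W /d -!mul_polyC !(polyCM, polyCD).
set dx := exp_poly _ x; set dy := exp_poly _ y.
set dz := exp_poly _ _.
move: (coth_poly _ x) (coth_poly _ y) (coth_poly _ _) => fx fy fz.
move: (x%:P) (y%:P) => a b; set ez := (ez in _ %| ez -> _) => ezP.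
set ey := (ey in _ %| ey -> _) => eyP; set ex := (ex in _ %| ex -> _) => exP.
set ed := (ed in _ %| ed -> _) => edP.
(* The congruences [ex], [ey] and [ez] eliminate [fx], [fy] and [fz]. What remains is 4 a b (a + b)
   ['X^2] times [ed], the defect of e^(x + y) = e^x e^y. *)
rewrite [X in _ %| X](_ : _ =
    (a + b) * (dy - 1) * ((dz - 1) * fy - b * 'X * (1 + dz)) * ex
  + (a + b) * a * 'X * ((dz - 1) * (1 + dx) - (1 + dz) * (dx - 1)) * ey
  - (dx - 1) * (dy - 1) * (b * fx + a * fy) * ez
  + 4 * a * b * (a + b) * 'X^2 * ed); last first.
  by rewrite /ex /ey /ez /ed; ring.
apply: dvdp_add; last exact: dvdp_mull.
apply: dvdp_sub; last exact: dvdp_mull.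
by apply: dvdp_add; exact: dvdp_mull.
Qed.

Lemma coth_coef_bernoulli n : n != 1 -> coth_coef n = bernoulli n / n`!%:R.
Proof. by rewrite /coth_coef => /negPf->; rewrite mul0r addr0. Qed.

Lemma big_ord_even (V : zmodType) (G : nat -> V) n :
  (forall k, odd k -> G k = 0) ->
  \sum_(k < (2 * n).+1) G k = \sum_(j < n.+1) G (2 * j)%N.
Proof.
move=> G0; rewrite big_ord_odd_even [X in _ + X]big1 ?addr0 // => j _.
by rewrite G0 //= mul2n odd_double.
Qed.

Lemma addr1i_neq0 : 1 + 'i != 0 :> algC.
Proof.
apply/eqP => i1; have /eqP := subr_sqr 1 ('i : algC).
by rewrite i1 mulr0 sqrCi expr1n opprK -(natrD _ 1 1) pnatr_eq0.
Qed.

(* Coefficient of t^4m in the addition formula at x = t and y = it. *)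
Lemma coth_coef_convolution_algC m : (0 < m)%N ->
  (1 + 'i) * \sum_(k < (2 * (2 * m)).+1)
     ratr (coth_coef (4 * m - k) * coth_coef k) * 'i ^+ k
  = \sum_(k < (2 * (2 * m)).+1)
      ratr (coth_coef (4 * m - k) * coth_coef k)
        * ((1 + 'i) ^+ k * ('i + 'i ^+ (4 * m - k))) :> algC.
Proof.
move=> m_gt0.
have /dvdXnP/(_ (4 * m)%N (leqnn _)) :=
  coth_poly_add (4 * m).+1 (oner_neq0 algC) (neq0Ci algC) addr1i_neq0.
rewrite mulnA coefD coefB !coefZ coefXn coefMr coefM.
rewrite (_ : (4 * m == 2)%N = false) ?mulr0 ?addr0; last by lia.
move=> /eqP; rewrite subr_eq0 => /eqP eq_coef.
(* Each [coth_poly] carries a factor 2, so their products carry 4. *)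
apply: (mulfI (_ : 4 != 0)); first by rewrite pnatr_eq0.
rewrite [LHS]mulrCA mulr_sumr [RHS]mulr_sumr.
have coefE (x : algC) k : (k <= 4 * m)%N ->
    (coth_poly (4 * m).+4 x)`_k = 2 * ratr (coth_coef k) * x ^+ k.
  by move=> le_k; rewrite coef_poly ifT //; lia.
transitivity ((1 + 'i) * \sum_(k < (4 * m).+1)
    (coth_poly (4 * m).+4 1)`_(4 * m - k) * (coth_poly (4 * m).+4 'i)`_k : algC).
  congr (_ * _); apply: eq_bigr => k _.
  by rewrite !coefE ?leq_subr ?leq_ord // expr1n rmorphM /=; ring.
rewrite eq_coef; apply: eq_bigr => k _.
rewrite coefD !coefZ !coefE ?leq_subr ?leq_ord // expr1n rmorphM /=; ring.
Qed.

(** Only even k survive in the convolution over [algC]. The weight (1 + i)^k (i + i^(4m - k)) is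
    (-4)^j (1 + i) at k = 4j, and (-4)^j 2i (i - 1) = -2 (-4)^j (1 + i) at k = 4j + 2. Cancelling 1
    + i leaves the two rational sums. *)
Lemma coth_coef_convolution m : (0 < m)%N ->
  \sum_(k < (2 * m).+1)
     (-1) ^+ k * coth_coef (4 * m - 2 * k) * coth_coef (2 * k)
  = \sum_(j < m.+1)
       (-4) ^+ j * coth_coef (4 * m - 4 * j) * coth_coef (4 * j)
    - 2 * \sum_(j < m)
       (-4) ^+ j * coth_coef (4 * m - 4 * j - 2) * coth_coef (4 * j + 2).
Proof.
move=> m_gt0; have i2 : 'i ^+ 2 = -1 :> algC := sqrCi _.
have a2 : (1 + 'i) ^+ 2 = 2 * 'i :> algC by rewrite sqrrD i2; ring.
have a4 : (1 + 'i) ^+ 4 = -4 :> algC by rewrite (exprM _ 2 2) a2 exprMn i2; ring.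
have i4 : 'i ^+ 4 = 1 :> algC by rewrite (exprM _ 2 2) i2; ring.
apply: (fmorph_inj (ratr : rat -> algC)); apply: (mulfI addr1i_neq0).
transitivity ((1 + 'i) * \sum_(k < (2 * (2 * m)).+1)
    ratr (coth_coef (4 * m - k) * coth_coef k) * 'i ^+ k : algC).
  rewrite (@big_ord_even _ (fun k => ratr (coth_coef (4 * m - k) * coth_coef k)
    * 'i ^+ k)); last first.
    by move=> k /coth_coef_odd->; rewrite mulr0 rmorph0 mul0r.
  congr (_ * _); rewrite rmorph_sum; apply: eq_bigr => k _.
  rewrite exprM i2 -mulrA rmorphM rmorphXn rmorphN1 /=; ring.
rewrite coth_coef_convolution_algC //.
rewrite (@big_ord_even _ (fun k => ratr (coth_coef (4 * m - k) * coth_coef k)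
    * ((1 + 'i) ^+ k * ('i + 'i ^+ (4 * m - k))))); last first.
  by move=> k /coth_coef_odd->; rewrite mulr0 rmorph0 mul0r.
pose G k : algC := ratr (coth_coef (4 * m - 2 * k) * coth_coef (2 * k))
  * ((1 + 'i) ^+ (2 * k) * ('i + 'i ^+ (4 * m - 2 * k))).
rewrite (big_ord_odd_even G) rmorphB mulrBr; congr (_ + _).
  rewrite rmorph_sum mulr_sumr; apply: eq_bigr => j _.
  rewrite /G (mulnA 2 2 j) -mulnBr (exprM _ (2 * 2)) a4 (exprM _ 4) i4 expr1n -mulrA.
  rewrite [in RHS]rmorphM rmorphXn rmorphN rmorph_nat /=; ring.
rewrite -mulrN -rmorphN -mulNr mulr_sumr rmorph_sum mulr_sumr.
apply: eq_bigr => j _; have lt_jm := ltn_ord j.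
have -> : G (2 * j).+1 = ratr (coth_coef (4 * m - 4 * j - 2) * coth_coef (4 * j + 2))
  * ((-4) ^+ j * ((1 + 'i) * -2)).
  rewrite /G (_ : 2 * (2 * j).+1 = 4 * j + 2)%N; last by lia.
  have i_exp : 'i ^+ (4 * m - (4 * j + 2)) = -1 :> algC.
    (* Since j < m, no subtraction is truncated and the exponent is 2 modulo 4. *)
    rewrite (_ : 4 * m - _ = 4 * (m - j.+1) + 2)%N; last by lia.
    by rewrite exprD exprM i4 expr1n i2 mul1r.
  rewrite i_exp subnDA exprD exprM a4 a2 -mulrA; congr (_ * (_ * _)).
  by rewrite mulrBr -mulrA -expr2 i2; ring.
rewrite ![in RHS]rmorphM rmorphXn !rmorphN !rmorph_nat /= rmorphM /=.
ring.
Qed.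

Theorem theorem11 (m : nat) (m_gt0 : (0 < m)%N) :
  \sum_(k < (2 * m).+1)
     (-1) ^+ k * (bernoulli (4 * m - 2 * k) / ((4 * m - 2 * k)`!)%:R)
               * (bernoulli (2 * k) / ((2 * k)`!)%:R)
  = \sum_(j < m.+1)
       (-4) ^+ j * (bernoulli (4 * m - 4 * j) / ((4 * m - 4 * j)`!)%:R)
                 * (bernoulli (4 * j) / ((4 * j)`!)%:R)
    - 2 * \sum_(j < m)
       (-4) ^+ j * (bernoulli (4 * m - 4 * j - 2) / ((4 * m - 4 * j - 2)`!)%:R)
                 * (bernoulli (4 * j + 2) / ((4 * j + 2)`!)%:R).
Proof.
(* Every index is even, hence different from 1, the only place where [coth_coef] departs from the
   Bernoulli quotient. *)
rewrite (eq_bigr (fun k : 'I__ => (-1) ^+ k * coth_coef (4 * m - 2 * k) * coth_coef (2 * k))).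
  rewrite coth_coef_convolution //; congr (_ - 2 * _); apply: eq_bigr => j _.
    by rewrite !coth_coef_bernoulli //; lia.
  by have := ltn_ord j; rewrite !coth_coef_bernoulli //; lia.
by move=> k _; rewrite !coth_coef_bernoulli //; lia.
Qed.
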